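(* Let $I\subseteq\mathbb{R}$ be a nonempty open interval and let $E:I^2\to\mathbb{R}$ be a quasideviation. Then the following conditions are equivalent to each other: (i) The quasideviation mean $\mathscr{D}_E$ is Jensen convex. (ii) For all $u\in I$, the map $x\mapsto E(x,u)$ has a positive right-derivative at $x=u$, denoted by $\partial_1^+E(u,u)$, and the mapping $E^+:I^2\to\mathbb{R}$ defined by $E^+(x,u):=\frac{E(x,u)}{\partial_1^+E(u,u)}$ is convex on $I^2$. (iii) For all $u\in I$, the map $x\mapsto E(x,u)$ has a positive left-derivative at $x=u$, denoted by $\partial_1^-E(u,u)$, and the mapping $E^-:I^2\to\mathbb{R}$ defined by $E^-(x,u):=\frac{E(x,u)}{\partial_1^-E(u,u)}$ is convex on $I^2$. Moreover, if any of the equivalent conditions (i), (ii), (iii) is satisfied, then the quasideviation $E$ and the quasideviation mean $\mathscr{D}_E$ possess the following properties: (a) $E$ is continuous on $I^2$. (b) For all $u\in I$, the function $I\ni x\mapsto E(x,u)$ is convex. (c) The function $I\ni u\mapsto (\partial_1^-E(u,u),\partial_1^+E(u,u))$ is continuous. (d) The map $I\ni u\mapsto \frac{\partial_1^+E(u,u)}{\partial_1^-E(u,u)}$ is constant. (e) $\mathscr{D}_E$ is nonsmaller than the arithmetic mean, that is, $\mathscr{D}_E(x_1,\dots,x_n)\geq\frac{x_1+\cdots+x_n}{n}$ for all $n\in\mathbb{N}$ and $x_1,\dots,x_n\in I$.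
   Context: $I$ is a nonempty open subinterval of $\mathbb{R}$. A function $E:I^2\to\mathbb{R}$ is called a quasideviation if: (D1) for all $x,u\in I$, $\operatorname{sign}E(x,u)=\operatorname{sign}(x-u)$; (D2) for all $x\in I$, the mapping $I\ni u\mapsto E(x,u)$ is continuous; (D3) for all $x,y\in I$ with $x<y$, the mapping $(x,y)\ni u\mapsto \frac{E(x,u)}{E(y,u)}$ is strictly decreasing. If $E$ is a quasideviation then (known fact) for all $n\in\mathbb{N}$ and $x_1,\dots,x_n\in I$ there is a unique $u\in I$ with $E(x_1,u)+\dots+E(x_n,u)=0$; this $u$ is called the $E$-quasideviation mean of $x_1,\dots,x_n$ and is denoted by $\mathscr{D}_E(x_1,\dots,x_n)$. Thus $\mathscr{D}_E:\bigcup_{n=1}^\infty I^n\to I$. A function $M:\bigcup_{n=1}^\infty I^n\to I$ which is a mean is said to be Jensen convex if, for all $n\in\mathbb{N}$ and all $x,y\in I^n$, $M\big(\frac{x+y}{2}\big)\leq\frac{M(x)+M(y)}{2}$. *)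

(* Defs.v *)
From HB Require Import structures.
From mathcomp Require Import all_boot all_order all_algebra.
From mathcomp Require Import all_classical all_reals all_analysis.

Set Implicit Arguments.
Unset Strict Implicit.
Unset Printing Implicit Defensive.

Import Order.TTheory GRing.Theory Num.Theory.
Import numFieldNormedType.Exports.

Local Open Scope classical_set_scope.
Local Open Scope ring_scope.

(* Functions on I or I^2 are represented by total functions on R; every notion
   below only depends on their values at points of I. *)

Definition quasideviation (R : realType) (I : set R) (E : R -> R -> R) : Prop :=
  [/\ forall x u, I x -> I u -> Num.sg (E x u) = Num.sg (x - u),
      forall x, I x -> {within I, continuous (E x)}
    & forall x y, I x -> I y -> x < y ->
        {in `]x, y[ &, forall u v, u < v -> E x v / E y v < E x u / E y u}].

(* For a quasideviation E, a vector x with 0 < n entries in I admits exactly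
   one such u; get returns an arbitrary value when there is none. *)
Definition qdmean (R : realType) (I : set R) (E : R -> R -> R)
    (n : nat) (x : 'rV[R]_n) : R :=
  get [set u | I u /\ \sum_(i < n) E (x ord0 i) u = 0].

Definition jensen_convex (R : realType) (I : set R)
    (M : forall n : nat, 'rV[R]_n -> R) : Prop :=
  forall (n : nat) (x y : 'rV[R]_n), (0 < n)%N ->
    (forall i, I (x ord0 i)) -> (forall i, I (y ord0 i)) ->
    M n (2^-1 *: (x + y)) <= (M n x + M n y) / 2.

Definition rderivable (R : realType) (f : R -> R) (a : R) : Prop :=
  cvg ((f x - f a) / (x - a) @[x --> a^'+]).

Definition rderive (R : realType) (f : R -> R) (a : R) : R :=
  lim ((f x - f a) / (x - a) @[x --> a^'+]).

Definition lderivable (R : realType) (f : R -> R) (a : R) : Prop :=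
  cvg ((f x - f a) / (x - a) @[x --> a^'-]).

Definition lderive (R : realType) (f : R -> R) (a : R) : R :=
  lim ((f x - f a) / (x - a) @[x --> a^'-]).

Definition rpartial1 (R : realType) (E : R -> R -> R) (u : R) : R :=
  rderive (E^~ u) u.

Definition lpartial1 (R : realType) (E : R -> R -> R) (u : R) : R :=
  lderive (E^~ u) u.

Definition rnormalized_convex (R : realType) (I : set R) (E : R -> R -> R) :
    Prop :=
  (forall u, I u -> rderivable (E^~ u) u /\ 0 < rpartial1 E u) /\
  @convex_function R (R^o * R^o)%type (I `*` I)
    (fun p => E p.1 p.2 / rpartial1 E p.2).

Definition lnormalized_convex (R : realType) (I : set R) (E : R -> R -> R) :
    Prop :=
  (forall u, I u -> lderivable (E^~ u) u /\ 0 < lpartial1 E u) /\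
  @convex_function R (R^o * R^o)%type (I `*` I)
    (fun p => E p.1 p.2 / lpartial1 E p.2).

(* Main.v *)
Require Import Defs.
From mathcomp Require Import all_boot all_order all_algebra.
From mathcomp Require Import all_classical all_reals all_analysis.
From mathcomp Require Import ring lra.
Import Order.TTheory GRing.Theory Num.Theory.
Import numFieldNormedType.Exports.
Local Open Scope classical_set_scope.
Local Open Scope ring_scope.

Set Implicit Arguments.
Unset Strict Implicit.
Unset Printing Implicit Defensive.

(** Write S_u(x) for the sum of the E(x_i, u).  By (D3), S_u changes sign exactly
    once as u grows, from positive to negative, so that D_E(x) <= v is the same
    as S_v(x) <= 0 ([qdmean_le]).  Everything about the mean is read off from
    that equivalence.

    If E(x,u)/s(u) is jointly convex for a positive normalization s, then
    summing its midpoint inequality at u = D_E(x), v = D_E(y) gives S_w <= 0 for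
    the midpoint vector at w = (u+v)/2, which is Jensen convexity of D_E
    ([normalized_convex_jensen]).

    Conversely, let D_E be Jensen convex.  A mean is bounded on segments, and a
    bounded Jensen convex function on a segment is convex; hence S_u(x) <= 0 and
    S_v(y) <= 0 imply S_w(tx+(1-t)y) <= 0 at w = tu+(1-t)v for every real t in
    [0,1] ([qd_sum_conv]).  This is applied to well chosen vectors with repeated
    entries.

    - Vectors that exchange x and y, completed by copies of a third point that
      tune the sign of the sum, give the Wright convexity of E(.,u)
      ([qd_wright]), which with the sign condition (D1) yields its convexity
      ([qd_convex]).  So E(.,u) has one-sided derivatives p(u) >= q(u) > 0 at u.

    - In the pair of vectors (x, a, ..., a, u, ..., u), (y, v, ..., v, b, ..., b)
      with m copies in each block, let a = u + O(1/m) and b = v + O(1/m) be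
      chosen so that both sums are just nonpositive.  When m grows, only the
      slopes of E at the diagonal survive in the resulting inequality, and
      E(tx+(1-t)y, w) is bounded by
      t k(w)/k(u) E(x,u) + (1-t) l(w)/l(v) E(y,v), where each of k and l is p or
      q according to the side on which a, b lie ([qd_compensated_conv]).

    - With x decreasing to u and y = v this says p(w)/q(w) <= p(u)/q(u) for all u
      and w.  Thus p/q is constant ([partial1_ratio]), so that k(w)/k(u) is the
      same for both sides, and the inequality is the joint convexity of
      E(x,u)/p(u) and of E(x,u)/q(u) ([qd_normalized_conv]).

    The additional properties follow from these convexities: convex functions
    are locally Lipschitz, which gives joint continuity of E and, through
    p(u) = E(x,u) / (E(x,u)/p(u)), continuity of p and q; and E(x,u) is at least
    p(u)(x-u), which bounds the mean below by the arithmetic one. *)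

(** * Open intervals *)

Section Intervals.
Context {R : realType} {I : set R}.
Hypotheses (I_open : open I) (I_itv : is_interval I).

Lemma interval_conv x y t : I x -> I y -> 0 <= t <= 1 ->
  I (t * x + (1 - t) * y).
Proof.
move=> Ix Iy /andP[t0 t1]; have [xy|/ltW yx] := leP x y.
  by apply: (I_itv Ix Iy); apply/andP; split; nra.
by apply: (I_itv Iy Ix); apply/andP; split; nra.
Qed.

Lemma open_room u : I u ->
  exists2 d : R, 0 < d & forall x, `|x - u| <= d -> I x.
Proof.
move=> Iu; have /nbhs_ballP[e /= e0 eI] : nbhs u I by exact: open_nbhs_nbhs.
exists (e / 2); first by rewrite divr_gt0.
move=> x xu; apply: eI; rewrite /ball /= distrC (le_lt_trans xu)//.
by rewrite ltr_pdivrMr// ltr_pMr// ltr1n.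
Qed.

Lemma open_below u : I u -> exists2 x : R, I x & x < u.
Proof.
move=> /open_room[d d0 dI]; exists (u - d); last by lra.
by apply: dI; rewrite addrAC subrr add0r normrN gtr0_norm.
Qed.

Lemma open_above u : I u -> exists2 x : R, I x & u < x.
Proof.
move=> /open_room[d d0 dI]; exists (u + d); last by lra.
by apply: dI; rewrite addrAC subrr add0r gtr0_norm.
Qed.

End Intervals.

(** * Quasideviations and their means *)

Lemma finite_bounds {R : realType} n (x : 'I_n -> R) : (0 < n)%N ->
  exists i j, forall k, x i <= x k <= x j.
Proof.
case: n x => // n x _.
case: (@arg_minP _ _ _ ord0 predT x isT) => i _ xi.
case: (@arg_maxP _ _ _ ord0 predT x isT) => j _ xj.
by exists i, j => k; rewrite xi//=; exact: xj.
Qed.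

Lemma ltr_sum_exists {R : realType} n (F G : 'I_n -> R) i0 :
  (forall i, F i <= G i) -> F i0 < G i0 -> \sum_i F i < \sum_i G i.
Proof.
move=> FG FG0; rewrite (bigD1 i0)//= [ltRHS](bigD1 i0)//=.
by apply: ltr_leD => //; exact: ler_sum.
Qed.

Section Quasideviation.
Context {R : realType} {I : set R} {E : R -> R -> R}.
Hypotheses (I_open : open I) (I_itv : is_interval I).
Hypothesis E_qd : quasideviation I E.

Lemma qd_gt0 x u : I x -> I u -> (0 < E x u) = (u < x).
Proof.
by case: E_qd => sE _ _ Ix Iu; rewrite -sgr_cp0 sE// sgr_cp0 subr_gt0.
Qed.

Lemma qd_lt0 x u : I x -> I u -> (E x u < 0) = (x < u).
Proof.
by case: E_qd => sE _ _ Ix Iu; rewrite -sgr_cp0 sE// sgr_cp0 subr_lt0.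
Qed.

Lemma qd_ge0 x u : I x -> I u -> (0 <= E x u) = (u <= x).
Proof. by move=> Ix Iu; rewrite leNgt qd_lt0// leNgt. Qed.

Lemma qd_le0 x u : I x -> I u -> (E x u <= 0) = (x <= u).
Proof. by move=> Ix Iu; rewrite leNgt qd_gt0// leNgt. Qed.

Lemma qd_diag u : I u -> E u u = 0.
Proof. by move=> Iu; apply/eqP; rewrite eq_le qd_le0// qd_ge0// lexx. Qed.

(** Cross-multiplied form of (D3).  Unlike the quotient form it also covers
    y = v, and x between u and v, where the signs from (D1) decide. *)
Lemma qd_cross x y u v : I x -> I y -> I u -> I v -> u < v -> x < v -> v <= y ->
  E x v * E y u < E x u * E y v.
Proof.
move=> Ix Iy Iu Iv uv xv vy.
have xv0 : E x v < 0 by rewrite qd_lt0.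
have yu0 : 0 < E y u by rewrite qd_gt0// (lt_le_trans uv).
have yv0 : 0 <= E y v by rewrite qd_ge0.
have [ux|xu] := leP u x.
  have : 0 <= E x u by rewrite qd_ge0.
  nra.
have xu0 : E x u < 0 by rewrite qd_lt0.
move: vy; rewrite le_eqVlt => /predU1P[vy|vy].
  by rewrite -[in ltRHS]vy qd_diag// mulr0 nmulr_rlt0.
case: E_qd => _ _ mono.
have := mono x y Ix Iy (lt_trans xv vy) u v.
rewrite !in_itv/= xu xv vy (lt_trans uv vy) => /(_ isT isT uv).
have yv1 : 0 < E y v by rewrite qd_gt0.
by rewrite ltr_pdivrMr// mulrAC ltr_pdivlMr.
Qed.

(** The sum crosses zero at most once, downwards.  With r the largest quotient
    E(x_j,v)/E(x_j,u) over the entries x_j >= v, maximality and (D3) make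
    r E(., u) dominate E(., v) at every entry, strictly at an entry not above u;
    so a nonpositive sum at u forces a negative one at v. *)
Lemma qd_sum_lt0 n (x : 'I_n -> R) u v : (0 < n)%N -> (forall i, I (x i)) ->
  I u -> I v -> u < v -> \sum_i E (x i) u <= 0 -> \sum_i E (x i) v < 0.
Proof.
move=> n0 Ix Iu Iv uv Su.
have [i0 [j0 x_bnd]] := finite_bounds x n0.
(* Without an entry above v every term at v is negative. *)
have [xv|vx] := ltP (x j0) v.
  have neg i : E (x i) v < 0.
    by rewrite qd_lt0//; have /andP[_ /le_lt_trans] := x_bnd i; exact.
  suff : \sum_i E (x i) v < \sum_(i < n) 0 by rewrite big1_eq.
  by apply: (ltr_sum_exists (i0 := j0)) => [i|]; [exact/ltW/neg|exact: neg].
pose r i := E (x i) v / E (x i) u.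
case: (@arg_maxP _ _ _ j0 (fun i => v <= x i) r vx) => j vxj rj.
have ju0 : 0 < E (x j) u by rewrite qd_gt0// (lt_le_trans uv).
have rj0 : 0 <= r j by rewrite divr_ge0 ?(ltW ju0)// qd_ge0.
have low i : x i < v -> E (x i) v < r j * E (x i) u.
  move=> xiv; rewrite /r mulrC mulrA ltr_pdivlMr//.
  exact: (qd_cross (Ix i) (Ix j) Iu Iv uv xiv vxj).
have dom i : E (x i) v <= r j * E (x i) u.
  have [vxi|/low/ltW//] := leP v (x i).
  have iu0 : 0 < E (x i) u by rewrite qd_gt0// (lt_le_trans uv).
  by rewrite -ler_pdivrMr//; exact: rj.
have i0u : x i0 <= u.
  rewrite leNgt; apply/negP => ui0; move: Su; rewrite leNgt => /negP; apply.
  have pos i : 0 < E (x i) u.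
    by rewrite qd_gt0//; have /andP[/(lt_le_trans ui0)] := x_bnd i.
  suff : \sum_(i < n) 0 < \sum_i E (x i) u by rewrite big1_eq.
  by apply: (ltr_sum_exists (i0 := i0)) => [i|]; [exact/ltW/pos|exact: pos].
have lt_sum : \sum_i E (x i) v < \sum_i r j * E (x i) u.
  by apply: (ltr_sum_exists (i0 := i0)) => //; exact/low/(le_lt_trans i0u).
by rewrite (lt_le_trans lt_sum)// -mulr_sumr mulr_ge0_le0.
Qed.

Lemma qdmean_exists n (x : 'I_n -> R) : (0 < n)%N -> (forall i, I (x i)) ->
  exists u, I u /\ \sum_i E (x i) u = 0.
Proof.
move=> n0 Ix; have [i [j x_bnd]] := finite_bounds x n0.
have ij : x i <= x j by have /andP[] := x_bnd j.
have subI : `[x i, x j] `<=` I.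
  by move=> z; rewrite /= in_itv/=; apply: I_itv.
have cS : {within `[x i, x j], continuous (fun u => \sum_k E (x k) u)}.
  apply: continuous_subspaceW subI _ => u.
  apply: cvg_big => [|k _]; first exact: add_continuous.
  by case: E_qd => _ cE _; exact: cE.
have [|u uij Su] := @IVT _ _ _ _ 0 ij cS.
  rewrite ge_min le_max; apply/andP; split; apply/orP; [right|left].
    by apply: sumr_le0 => k _; rewrite qd_le0//; have /andP[] := x_bnd k.
  by apply: sumr_ge0 => k _; rewrite qd_ge0//; have /andP[] := x_bnd k.
by exists u; split => //; exact: subI.
Qed.

Lemma qdmeanP n (x : 'rV[R]_n) : (0 < n)%N -> (forall i, I (x ord0 i)) ->
  I (qdmean I E x) /\ \sum_i E (x ord0 i) (qdmean I E x) = 0.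
Proof.
move=> n0 Ix; have [u Su] := qdmean_exists n0 Ix.
exact: (@getPex _ [set u | I u /\ \sum_i E (x ord0 i) u = 0] (ex_intro _ u Su)).
Qed.

(** The only information about the mean used below: comparing it with a point
    amounts to the sign of the sum at that point. *)
Lemma qdmean_le n (x : 'rV[R]_n) v : (0 < n)%N -> (forall i, I (x ord0 i)) ->
  I v -> (qdmean I E x <= v) = (\sum_i E (x ord0 i) v <= 0).
Proof.
move=> n0 Ix Iv; have [ID SD] := qdmeanP n0 Ix.
apply/idP/idP => [|Sv].
  rewrite le_eqVlt => /predU1P[<-|Dv]; first by rewrite SD.
  by apply/ltW/(@qd_sum_lt0 n (x ord0) (qdmean I E x) v) => //; rewrite SD.
rewrite leNgt; apply/negP => vD.
by have := qd_sum_lt0 n0 Ix Iv ID vD Sv; rewrite SD ltxx.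
Qed.

End Quasideviation.

(** * Jensen convexity and convexity *)

Definition convex_on {R : realType} (I : set R) (f : R -> R) :=
  forall x y t, I x -> I y -> 0 <= t <= 1 ->
    f (t * x + (1 - t) * y) <= t * f x + (1 - t) * f y.

Lemma convex_functionP {R : realType} (I : set R) (f : R -> R) :
  @convex_function R R^o I f <-> convex_on I f.
Proof.
split=> [fC x y t Ix Iy /andP[t0 t1]|fC t x y /set_mem Ix /set_mem Iy].
  exact: (fC (Itv01 t0 t1) x y (mem_set Ix) (mem_set Iy)).
by apply: fC => //; rewrite ge0 le1.
Qed.

(** Let h be the difference between g and its chord; it is Jensen convex and
    vanishes at 0 and 1.  Each t in [0,1] is the midpoint of an endpoint and
    another point of [0,1], so an upper bound of h can be halved indefinitely. *)
Lemma jensen_bounded_le {R : realType} (g : R -> R) (M : R) :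
  (forall s t, 0 <= s <= 1 -> 0 <= t <= 1 ->
    g ((s + t) / 2) <= (g s + g t) / 2) ->
  (forall t, 0 <= t <= 1 -> g t <= M) ->
  forall t, 0 <= t <= 1 -> g t <= t * g 1 + (1 - t) * g 0.
Proof.
move=> gJ gM.
pose h t := g t - (t * g 1 + (1 - t) * g 0).
have hJ s t : 0 <= s <= 1 -> 0 <= t <= 1 -> h ((s + t) / 2) <= (h s + h t) / 2.
  by move=> s01 t01; have := gJ s t s01 t01; rewrite /h; lra.
have h0 : h 0 = 0 by rewrite /h; ring.
have h1 : h 1 = 0 by rewrite /h; ring.
pose B := `|M| + `|g 0| + `|g 1|.
have hB n t : 0 <= t <= 1 -> h t <= B / 2 ^+ n.
  elim: n t => [|n IHn] t t01.
    have := gM t t01; have := ler_norm M; have := ler_norm (- g 0).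
    have := ler_norm (- g 1); rewrite !normrN expr0 divr1 /h /B.
    have := normr_ge0 (g 0); have := normr_ge0 (g 1); move: t01 => /andP[].
    nra.
  have -> : B / 2 ^+ n.+1 = (B / 2 ^+ n) / 2 by rewrite exprSr invfM mulrA.
  have [t2|t2] := leP t (1 / 2).
    have t01' : 0 <= 2 * t <= 1 by move: t01; lra.
    have := hJ 0 (2 * t); rewrite h0 t01' lexx ler01 => /(_ isT isT).
    have -> : (0 + 2 * t) / 2 = t by field.
    by have := IHn _ t01'; lra.
  have t01' : 0 <= 2 * t - 1 <= 1 by move: t01; lra.
  have := hJ 1 (2 * t - 1); rewrite h1 t01' lexx ler01 => /(_ isT isT).
  have -> : (1 + (2 * t - 1)) / 2 = t by field.
  by have := IHn _ t01'; lra.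
move=> t t01; rewrite leNgt -subr_gt0; apply/negP => ht0.
have {hB} := hB (Num.bound (B / h t)) t t01.
rewrite ler_pdivlMr ?exprn_gt0// mulrC -ler_pdivlMr// leNgt.
by rewrite upper_nthrootP.
Qed.

Lemma jensen_bounded_convex {R : realType} (I : set R) (f : R -> R) :
  is_interval I ->
  (forall x y, I x -> I y -> f ((x + y) / 2) <= (f x + f y) / 2) ->
  (forall x y, I x -> I y ->
    exists M, forall t, 0 <= t <= 1 -> f (t * x + (1 - t) * y) <= M) ->
  convex_on I f.
Proof.
move=> I_itv fJ fB x y t Ix Iy t01; have [M fM] := fB x y Ix Iy.
have := @jensen_bounded_le R (fun t => f (t * x + (1 - t) * y)) M _ fM t t01.
rewrite mul1r subrr mul0r addr0 mul0r subr0 mul1r add0r; apply.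
move=> r s r01 s01.
have -> : (r + s) / 2 * x + (1 - (r + s) / 2) * y =
  ((r * x + (1 - r) * y) + (s * x + (1 - s) * y)) / 2 by field.
by apply: fJ; exact: interval_conv.
Qed.

(** * One-sided derivatives and continuity of convex functions *)

Section ConvexOnInterval.
Context {R : realType} {I : set R} {f : R -> R}.
Hypotheses (I_open : open I) (f_convex : convex_on I f).

Lemma convex_chord a b c : I a -> I c -> a < b < c ->
  f b * (c - a) <= (c - b) * f a + (b - a) * f c.
Proof.
move=> Ia Ic /andP[ab bc]; have ac : 0 < c - a by lra.
have t01 : 0 <= (c - b) / (c - a) <= 1.
  by rewrite ler_pdivrMr// mul1r divr_ge0 /=; lra.
have := f_convex Ia Ic t01.
have -> : (c - b) / (c - a) * a + (1 - (c - b) / (c - a)) * c = b.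
  by field; rewrite gt_eqF.
rewrite -(ler_pM2r ac) => /le_trans; apply.
rewrite le_eqVlt; apply/orP; left; apply/eqP.
by field; rewrite gt_eqF.
Qed.

Lemma convex_slope_le a x y : I a -> I x -> I y -> x != a -> y != a -> x <= y ->
  (f x - f a) / (x - a) <= (f y - f a) / (y - a).
Proof.
move=> Ia Ix Iy xa ya; rewrite le_eqVlt => /predU1P[->//|xy].
have [ax|xa'|xa'] := ltgtP a x; last by rewrite xa' eqxx in xa.
  have := convex_chord Ia Iy (_ : a < x < y); rewrite ax xy => /(_ isT) H.
  have x0 : 0 < x - a by lra.
  have y0 : 0 < y - a by lra.
  rewrite ler_pdivrMr// mulrAC ler_pdivlMr//. nra.
rewrite -[leLHS]mulrNN -invrN !opprB.
have x0 : 0 < a - x by lra.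
have [ay|ya'|ya'] := ltgtP a y; last by rewrite ya' eqxx in ya.
  have := convex_chord Ix Iy (_ : x < a < y); rewrite xa' ay => /(_ isT) H.
  have y0 : 0 < y - a by lra.
  by rewrite ler_pdivrMr// mulrAC ler_pdivlMr//; nra.
rewrite -[leRHS]mulrNN -invrN !opprB.
have := convex_chord Ix Ia (_ : x < y < a); rewrite xy ya' => /(_ isT) H.
have y0 : 0 < a - y by lra.
by rewrite ler_pdivrMr// mulrAC ler_pdivlMr//; nra.
Qed.

Lemma convex_rderivable u : I u -> rderivable f u.
Proof.
move=> Iu; have [d d0 dI] := open_room I_open Iu.
have subI x : u < x < u + d -> I x.
  by move=> /andP[ux xd]; apply: dI; rewrite ger0_norm; lra.
apply: nondecreasing_at_right_is_cvgr.
  near=> b => x y; rewrite !in_itv/= => /andP[ux xb] /andP[uy yb] xy.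
  have bd : b < u + d by near: b; apply: nbhs_right_lt; lra.
  apply: convex_slope_le => //; rewrite ?gt_eqF//; apply: subI;
    [rewrite ux (lt_trans xb)//|rewrite uy (lt_trans yb)//].
near=> b; have bd : b < u + d by near: b; apply: nbhs_right_lt; lra.
exists ((f (u - d) - f u) / (u - d - u)) => _ [x + <-].
rewrite /= in_itv/= => /andP[ux xb].
have Iud : I (u - d) by apply: dI; rewrite ler0_norm; lra.
apply: convex_slope_le => //; [|by rewrite lt_eqF//; lra|by rewrite gt_eqF|lra].
by apply: subI; rewrite ux (lt_trans xb).
Unshelve. all: by end_near. Qed.

Lemma convex_lderivable u : I u -> lderivable f u.
Proof.
move=> Iu; have [d d0 dI] := open_room I_open Iu.
have subI x : u - d < x < u -> I x.
  by move=> /andP[xd xu]; apply: dI; rewrite ler0_norm; lra.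
apply: nondecreasing_at_left_is_cvgr.
  near=> b => x y; rewrite !in_itv/= => /andP[bx xu] /andP[by_ yu] xy.
  have bd : u - d < b by near: b; apply: nbhs_left_gt; lra.
  apply: convex_slope_le => //; rewrite ?lt_eqF//; apply: subI;
    [rewrite xu (lt_trans bd)//|rewrite yu (lt_trans bd)//].
near=> b; have bd : u - d < b by near: b; apply: nbhs_left_gt; lra.
exists ((f (u + d) - f u) / (u + d - u)) => _ [x + <-].
rewrite /= in_itv/= => /andP[bx xu].
have Iud : I (u + d) by apply: dI; rewrite ger0_norm; lra.
apply: convex_slope_le => //; [|by rewrite lt_eqF|by rewrite gt_eqF//; lra|lra].
by apply: subI; rewrite xu (lt_trans bd).
Unshelve. all: by end_near. Qed.

Lemma near_right_in u : I u -> \forall x \near u^'+, I x.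
Proof.
move=> Iu; have [d d0 dI] := open_room I_open Iu.
near=> x; apply: dI; rewrite ger0_norm ?subr_ge0; last first.
  by near: x; exact: nbhs_right_ge.
have : x <= u + d by near: x; apply: nbhs_right_le; lra.
lra.
Unshelve. all: by end_near. Qed.

Lemma near_left_in u : I u -> \forall x \near u^'-, I x.
Proof.
move=> Iu; have [d d0 dI] := open_room I_open Iu.
near=> x; apply: dI; rewrite ler0_norm ?subr_le0; last first.
  by near: x; exact: nbhs_left_le.
have : u - d <= x by near: x; apply: nbhs_left_ge; lra.
lra.
Unshelve. all: by end_near. Qed.

Lemma convex_ge_rderive u x : I u -> I x -> u <= x ->
  rderive f u * (x - u) <= f x - f u.
Proof.
move=> Iu Ix; rewrite le_eqVlt => /predU1P[->|ux].
  by rewrite !subrr mulr0.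
rewrite -ler_pdivlMr ?subr_gt0//; apply: limr_le.
  exact: convex_rderivable.
near=> y; have uy : u < y by near: y; exact: nbhs_right_gt.
apply: convex_slope_le => //; rewrite ?gt_eqF//.
  by near: y; exact: near_right_in.
by near: y; exact: nbhs_right_le.
Unshelve. all: by end_near. Qed.

Lemma convex_ge_lderive u x : I u -> I x -> x <= u ->
  lderive f u * (x - u) <= f x - f u.
Proof.
move=> Iu Ix; rewrite le_eqVlt => /predU1P[->|xu].
  by rewrite !subrr mulr0.
rewrite -ler_ndivrMr ?subr_lt0//; apply: limr_ge.
  exact: convex_lderivable.
near=> y; have yu : y < u by near: y; exact: nbhs_left_lt.
apply: convex_slope_le => //; rewrite ?lt_eqF//.
  by near: y; exact: near_left_in.
by near: y; exact: nbhs_left_ge.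
Unshelve. all: by end_near. Qed.

Lemma convex_lderive_le_rderive u : I u -> lderive f u <= rderive f u.
Proof.
move=> Iu; apply: limr_le; first exact: convex_lderivable.
near=> y; have yu : y < u by near: y; exact: nbhs_left_lt.
have Iy : I y by near: y; exact: near_left_in.
apply: limr_ge; first exact: convex_rderivable.
near=> z; have uz : u < z by near: z; exact: nbhs_right_gt.
apply: convex_slope_le => //; [|].
  by near: z; exact: near_right_in.
exact/ltW/(lt_trans yu).
Unshelve. all: by end_near. Qed.

Lemma rderive_lt_near u b : I u -> rderive f u < b ->
  exists2 d : R, 0 < d & forall x, u < x < u + d -> f x - f u <= b * (x - u).
Proof.
move=> Iu ub.
have /nbhs_ballP[d /= d0 dP] : \forall x \near u^'+, (f x - f u) / (x - u) < b.
  exact: (cvgr_lt _ (convex_rderivable Iu)).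
exists d => // x /andP[ux xd].
rewrite -ler_pdivrMr ?subr_gt0// ltW//; apply: dP => //.
by rewrite /ball/= ler0_norm; lra.
Qed.

Lemma lt_lderive_near u b : I u -> b < lderive f u ->
  exists2 d : R, 0 < d & forall x, u - d < x < u -> f x - f u <= b * (x - u).
Proof.
move=> Iu ub.
have /nbhs_ballP[d /= d0 dP] : \forall x \near u^'-, b < (f x - f u) / (x - u).
  exact: (cvgr_gt _ (convex_lderivable Iu)).
exists d => // x /andP[xd xu].
rewrite -ler_ndivlMr ?subr_lt0// ltW//; apply: dP => //.
by rewrite /ball/= ger0_norm; lra.
Qed.

(** The slope from u to x lies between the slopes from u to u - d and from u to
    u + d. *)
Lemma convex_lipschitz u d x : 0 < d -> I (u - d) -> I u -> I (u + d) -> I x ->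
  `|x - u| <= d ->
  `|f x - f u| <= `|x - u| / d * (`|f (u + d) - f u| + `|f (u - d) - f u|).
Proof.
move=> d0 Iud Iu Iud' Ix xd.
have A := ler_norm (f (u + d) - f u); have B := ler_norm (f (u - d) - f u).
set a := `|f (u + d) - f u| in A *; set b := `|f (u - d) - f u| in B *.
have a0 : 0 <= a by exact: normr_ge0.
have b0 : 0 <= b by exact: normr_ge0.
have [->|xu] := eqVneq x u; first by rewrite !subrr normr0 !mul0r.
have [xl xr] : u - d <= x /\ x <= u + d.
  by move: xd; rewrite ler_distl => /andP[].
have ud : u - d != u by rewrite lt_eqF//; lra.
have ud' : u + d != u by rewrite gt_eqF//; lra.
have := convex_slope_le Iu Iud Ix ud xu xl.
have := convex_slope_le Iu Ix Iud' xu ud' xr.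
have -> : u + d - u = d by ring.
have -> : u - d - u = - d by ring.
rewrite invrN mulrN -mulNr; set s := (f x - f u) / (x - u) => sr sl.
have -> : f x - f u = s * (x - u) by rewrite /s divfK// subr_eq0.
rewrite normrM mulrC -mulrA ler_wpM2l// ler_norml -mulrN1 -mulrA.
apply/andP; split.
  apply: le_trans sl.
  by rewrite mulrN1 mulrN mulrC -mulNr ler_pM2r ?invr_gt0//; lra.
by apply: le_trans sr _; rewrite mulrC ler_pM2l ?invr_gt0//; lra.
Qed.

End ConvexOnInterval.

Lemma cvg_dominated {R : realType} {T : Type} {F : set_system T} {FF : Filter F}
    (g B : T -> R) (l : R) :
  (\forall x \near F, `|g x - l| <= B x) -> B x @[x --> F] --> (0 : R) ->
  g x @[x --> F] --> l.
Proof.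
move=> gB B0; apply/cvgrPdist_lt => e e0; near=> x.
rewrite distrC; apply: le_lt_trans (_ : B x < e); first by near: x.
by near: x; exact: (cvgr_lt _ B0).
Unshelve. all: by end_near. Qed.

Lemma convex_continuous {R : realType} (I : set R) (f : R -> R) (u : R) :
  open I -> convex_on I f -> I u -> {for u, continuous f}.
Proof.
move=> I_open fC Iu; have [d d0 dI] := open_room I_open Iu.
pose C := `|f (u + d) - f u| + `|f (u - d) - f u|.
apply: (@cvg_dominated _ _ _ _ _ (fun x => `|x - u| / d * C)).
  near=> x; have xd : `|x - u| <= d.
    by near: x; apply: cvgr_distC_le => //; exact: cvg_id.
  by apply: (convex_lipschitz fC) => //; apply: dI => //;
    rewrite addrAC subrr add0r ?normrN gtr0_norm.
rewrite [X in _ --> X](_ : 0 = `|u - u| / d * C); last first.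
  by rewrite subrr normr0 !mul0r.
apply: cvgM; last exact: cvg_cst.
apply: cvgM; last exact: cvg_cst.
by apply: cvg_norm; apply: cvgB; [exact: cvg_id|exact: cvg_cst].
Unshelve. all: by end_near. Qed.

(** * Convexity of the mean and of the sections of the quasideviation *)

(** A rational number between a/c and b/c, as a pair of multiplicities. *)
Lemma nat_ratio_between {R : realType} (a b c : R) :
  0 <= a -> a < b -> 0 < c ->
  exists n k : nat, n%:R * a < k%:R * c /\ k%:R * c < n%:R * b.
Proof.
move=> a0 ab c0; pose n := (Num.truncn (c / (b - a))).+1.
have nP : c < n%:R * (b - a) by rewrite -ltr_pdivrMr ?subr_gt0// truncnS_gt.
pose k := Num.truncn (n%:R * a / c).
have k_le : k%:R * c <= n%:R * a.
  by rewrite -ler_pdivlMr// truncn_le divr_ge0 ?mulr_ge0// ltW.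
have k_gt : n%:R * a < k.+1%:R * c by rewrite -ltr_pdivrMr// truncnS_gt.
exists n, k.+1; split=> //.
by rewrite -natr1 mulrDl mul1r; move: nP k_le; rewrite mulrBr; lra.
Qed.

Lemma sum_nseq {R : pzSemiRingType} (T : Type) n (a : T) (F : T -> R) :
  \sum_(p <- nseq n a) F p = n%:R * F a.
Proof. by rewrite big_nseq iter_addr_0 mulr_natl. Qed.

Section JensenConvexMean.
Context {R : realType} {I : set R} {E : R -> R -> R}.
Hypotheses (I_open : open I) (I_itv : is_interval I).
Hypothesis E_qd : quasideviation I E.
Hypothesis D_jensen : jensen_convex I (@qdmean R I E).

(** Real weights instead of 1/2: along a segment the mean never exceeds the
    largest entry of the two vectors, so Jensen convexity suffices. *)
Lemma qdmean_conv n (x y : 'rV[R]_n) t : (0 < n)%N ->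
  (forall i, I (x ord0 i)) -> (forall i, I (y ord0 i)) -> 0 <= t <= 1 ->
  qdmean I E (t *: x + (1 - t) *: y) <=
    t * qdmean I E x + (1 - t) * qdmean I E y.
Proof.
move=> n0 Ix Iy t01.
have Iz s : 0 <= s <= 1 -> forall i, I ((s *: x + (1 - s) *: y) ord0 i).
  by move=> s01 i; rewrite !mxE; exact: interval_conv.
have [i' [i xi]] := finite_bounds (x ord0) n0.
have [j' [j yj]] := finite_bounds (y ord0) n0.
pose b := Num.max (x ord0 i) (y ord0 j).
have Ib : I b by rewrite /b; case: ltP.
have g_le s : 0 <= s <= 1 -> qdmean I E (s *: x + (1 - s) *: y) <= b.
  move=> s01; rewrite (qdmean_le I_itv E_qd n0 (Iz s s01) Ib).
  apply: sumr_le0 => k _; rewrite (qd_le0 E_qd)//; last exact: Iz.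
  have /andP[_ xk] := xi k; have /andP[_ yk] := yj k.
  have xb : x ord0 k <= b by rewrite (le_trans xk)// /b le_max lexx.
  have yb : y ord0 k <= b by rewrite (le_trans yk)// /b le_max lexx orbT.
  by rewrite !mxE; move: s01 => /andP[]; nra.
have := @jensen_bounded_le R
  (fun s => qdmean I E (s *: x + (1 - s) *: y)) b _ g_le t t01.
rewrite !(scale1r, subrr, scale0r, addr0, subr0, add0r); apply.
move=> r s r01 s01.
have -> : ((r + s) / 2) *: x + (1 - (r + s) / 2) *: y =
   2^-1 *: ((r *: x + (1 - r) *: y) + (s *: x + (1 - s) *: y)).
  by apply/rowP => k; rewrite !mxE; field.
by apply: D_jensen => //; exact: Iz.
Qed.

(** Jensen convexity of the mean in terms of sums.  A list of pairs holds the
    two vectors, so that repeated entries can be written with [nseq]. *)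
Lemma qd_sum_conv (s : seq (R * R)) u v t :
  {in s, forall p, I p.1 /\ I p.2} -> I u -> I v -> 0 <= t <= 1 ->
  \sum_(p <- s) E p.1 u <= 0 -> \sum_(p <- s) E p.2 v <= 0 ->
  \sum_(p <- s) E (t * p.1 + (1 - t) * p.2) (t * u + (1 - t) * v) <= 0.
Proof.
have [->|s_neq0] := eqVneq s [::]; first by rewrite !big_nil.
move=> Is Iu Iv t01; rewrite !(big_nth (0, 0)) !big_mkord => Su Sv.
have n0 : (0 < size s)%N by rewrite lt0n size_eq0.
pose x : 'rV[R]_(size s) := \row_i (nth (0, 0) s i).1.
pose y : 'rV[R]_(size s) := \row_i (nth (0, 0) s i).2.
have Ix i : I (x ord0 i) by rewrite mxE; apply: (Is _ (mem_nth _ _)).1.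
have Iy i : I (y ord0 i) by rewrite mxE; apply: (Is _ (mem_nth _ _)).2.
have xu : qdmean I E x <= u.
  by rewrite (qdmean_le I_itv E_qd)//; under eq_bigr do rewrite mxE.
have yv : qdmean I E y <= v.
  by rewrite (qdmean_le I_itv E_qd)//; under eq_bigr do rewrite mxE.
have Iz i : I ((t *: x + (1 - t) *: y) ord0 i).
  by rewrite !mxE; apply: interval_conv; rewrite // -1?[_.1]mxE;
    [have := Ix i|have := Iy i]; rewrite mxE.
have Iw : I (t * u + (1 - t) * v) by exact: interval_conv.
have : qdmean I E (t *: x + (1 - t) *: y) <= t * u + (1 - t) * v.
  apply: le_trans (qdmean_conv n0 Ix Iy t01) _.
  by move: t01 => /andP[]; nra.
rewrite (qdmean_le I_itv E_qd n0 Iz Iw).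
by under eq_bigr do rewrite !mxE.
Qed.

(** If the left-hand side G exceeded the right-hand side F, then n copies of
    each of (x, y) and (y, x), with k copies of (z, z) chosen so that
    n F + k E(z,u) <= 0 < n G + k E(z,u), would contradict [qd_sum_conv]: both
    vectors have the same sum, and their combination has the larger one. *)
Lemma qd_wright x y u t : I x -> I y -> I u -> 0 <= t <= 1 ->
  E (t * x + (1 - t) * y) u + E (t * y + (1 - t) * x) u <= E x u + E y u.
Proof.
move=> Ix Iy Iu t01.
set G := leLHS; set F := leRHS; rewrite leNgt; apply/negP => FG.
suff [n [k [z [Iz Fz Gz]]]] : exists n k z,
    [/\ I z, n%:R * F + k%:R * E z u <= 0 & 0 < n%:R * G + k%:R * E z u].
  have := @qd_sum_conv (nseq n (x, y) ++ nseq n (y, x) ++ nseq k (z, z)) u u t.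
  rewrite !big_cat !sum_nseq/=.
  have <- : u = t * u + (1 - t) * u by ring.
  have <- : z = t * z + (1 - t) * z by ring.
  rewrite !addrA -!mulrDr [E y u + _]addrC -/F -/G.
  move=> H; move: Gz; rewrite ltNge => /negP; apply; apply: H => // p.
  by rewrite !mem_cat !mem_nseq => /or3P[]/andP[_ /eqP->].
(* The third point lies below u to lower F, above u to raise G;
   when F < 0 < G, k = 0 does. *)
have [F0|F0] := ltP F 0; last first.
  have [z Iz zu] := open_below I_open Iu.
  have [|n [k [nF nG]]] := nat_ratio_between F0 FG (_ : 0 < - E z u).
    by rewrite oppr_gt0 (qd_lt0 E_qd).
  by exists n, k, z; split=> //; lra.
have [G0|G0] := ltP 0 G.
  by exists 1%N, 0%N, u; split=> //; lra.
have [z Iz uz] := open_above I_open Iu.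
have [|||n [k [nG nF]]] := @nat_ratio_between _ (- G) (- F) (E z u).
- by rewrite oppr_ge0.
- by rewrite ltrN2.
- by rewrite (qd_gt0 E_qd).
by exists n, k, z; split=> //; lra.
Qed.

(** Wright convexity at t = 1/2 is Jensen convexity.  Boundedness on segments
    comes from the sign condition: E(., u) is nonpositive on the left of u,
    while for z between u and b the reflected point u + b - z is not below u, so
    that E(z,u) <= E(z,u) + E(u+b-z,u) <= E(b,u). *)
Lemma qd_convex u : I u -> convex_on I (E^~ u).
Proof.
move=> Iu; apply: jensen_bounded_convex => // x y Ix Iy.
  have /= := @qd_wright x y u 2^-1 Ix Iy Iu.
  have -> : 2^-1 * x + (1 - 2^-1) * y = (x + y) / 2 by field.
  have -> : 2^-1 * y + (1 - 2^-1) * x = (x + y) / 2 by field.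
  have h : (0 : R) <= 2^-1 <= (1 : R) by lra.
  by move=> /(_ h); lra.
pose b := Num.max u (Num.max x y).
have Ib : I b by rewrite /b; case: ltP => _ //; case: ltP.
exists (E b u) => t t01; set z := _ + _.
have Iz : I z by exact: interval_conv.
have zb : z <= b.
  have xb : x <= b by rewrite /b !le_max lexx orbT.
  have yb : y <= b by rewrite /b !le_max lexx !orbT.
  by move: t01 => /andP[]; rewrite /z; nra.
have ub : u <= b by rewrite /b le_max lexx.
have Eb0 : 0 <= E b u by rewrite (qd_ge0 E_qd).
have [zu|uz] := leP z u.
  by apply: le_trans Eb0; rewrite (qd_le0 E_qd).
have ub' : 0 < b - u by rewrite subr_gt0 (lt_le_trans uz).
pose s := (z - u) / (b - u).
have s01 : 0 <= s <= 1.
  by rewrite divr_ge0 ?subr_ge0 ?(ltW uz)//= ler_pdivrMr// mul1r lerD2r.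
have := @qd_wright b u u s Ib Iu Iu s01; rewrite (qd_diag E_qd Iu) addr0.
have -> : s * b + (1 - s) * u = z.
  by rewrite /s; field; rewrite gt_eqF.
suff : 0 <= E (s * u + (1 - s) * b) u by lra.
rewrite (qd_ge0 E_qd)//; last exact: interval_conv.
by move: s01 => /andP[]; nra.
Qed.

End JensenConvexMean.

(** * Slopes of the quasideviation at the diagonal *)

(** The slope at the diagonal that matters when entries near u compensate
    E(x,u): these entries lie on the side of u opposite to x. *)
Definition compensating_slope (R : realType) (E : R -> R -> R) (u x : R) :
    R -> R :=
  if u <= x then lpartial1 E else rpartial1 E.

Section ConvexSections.
Context {R : realType} {I : set R} {E : R -> R -> R}.
Hypothesis I_open : open I.
Hypothesis E_qd : quasideviation I E.
Hypothesis E_convex : forall u, I u -> convex_on I (E^~ u).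

Lemma qd_ge_rpartial1 u x : I u -> I x -> u <= x ->
  rpartial1 E u * (x - u) <= E x u.
Proof.
move=> Iu Ix ux; have := convex_ge_rderive I_open (E_convex Iu) Iu Ix ux.
by rewrite (qd_diag E_qd Iu) subr0.
Qed.

Lemma qd_ge_lpartial1 u x : I u -> I x -> x <= u ->
  lpartial1 E u * (x - u) <= E x u.
Proof.
move=> Iu Ix xu; have := convex_ge_lderive I_open (E_convex Iu) Iu Ix xu.
by rewrite (qd_diag E_qd Iu) subr0.
Qed.

Lemma lpartial1_gt0 u : I u -> 0 < lpartial1 E u.
Proof.
move=> Iu; have [x Ix xu] := open_below I_open Iu.
have := qd_ge_lpartial1 Iu Ix (ltW xu).
have : E x u < 0 by rewrite (qd_lt0 E_qd).
by move=> /[swap] /le_lt_trans /[apply]; rewrite nmulr_llt0// subr_lt0.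
Qed.

Lemma rpartial1_gt0 u : I u -> 0 < rpartial1 E u.
Proof.
move=> Iu; apply: lt_le_trans (lpartial1_gt0 Iu) _.
exact: (convex_lderive_le_rderive I_open (E_convex Iu)).
Qed.

Lemma compensating_slope_gt0 u x w : I w -> 0 < compensating_slope E u x w.
Proof.
by rewrite /compensating_slope; case: ifP => _ Iw;
  [exact: lpartial1_gt0|exact: rpartial1_gt0].
Qed.

(** With h = 1/m, the m entries u + s/m outweigh E(x,u) at u, and the m entries
    w + t s/m have at w a sum of at least -t k(w)/k(u) (E(x,u) + eps), where k is
    the compensating slope.  The first property uses that the slope at u is the
    limit of difference quotients, the second that the slope at w bounds them. *)
Lemma compensate u x eps : I u -> I x -> 0 < eps ->
  exists s d, [/\ 0 < d,
    forall h, 0 < h < d -> I (u + s * h) /\ h * E x u + E (u + s * h) u <= 0 &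
    forall w t h, I w -> 0 <= t <= 1 -> 0 < h -> I (w + t * (s * h)) ->
      - E (w + t * (s * h)) w <=
      h * (t * (compensating_slope E u x w / compensating_slope E u x u)
             * (E x u + eps))].
Proof.
move=> Iu Ix eps0; rewrite /compensating_slope.
have [d1 d10 d1I] := open_room I_open Iu.
have [ux|xu] := leP u x.
(* The slope b is the one for which b * s = - E x u. *)
- have q0 := lpartial1_gt0 Iu; set q := lpartial1 E u in q0 *.
  have e0 : 0 <= E x u by rewrite (qd_ge0 E_qd).
  set e := E x u in e0 *.
  have ee0 : 0 < e + eps by lra.
  have bq : q * e / (e + eps) < q by rewrite ltr_pdivrMr// ltr_pM2l//; lra.
  have [d2 d20 d2P] := lt_lderive_near I_open (E_convex Iu) Iu bq.
  pose s := - ((e + eps) / q).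
  have s0 : s < 0 by rewrite oppr_lt0 divr_gt0.
  exists s, (Num.min d1 d2 / - s); split.
  + by rewrite divr_gt0 ?oppr_gt0// lt_min d10.
  + move=> h /andP[h0].
    rewrite ltr_pdivlMr ?oppr_gt0// lt_min => /andP[hd1 hd2].
    have sh0 : s * h < 0 by rewrite nmulr_rlt0.
    split; first by apply: d1I; rewrite ler0_norm; lra.
    have := d2P (u + s * h); rewrite (qd_diag E_qd Iu) subr0.
    have -> : q * e / (e + eps) * (u + s * h - u) = - (h * e).
      by rewrite /s; field; rewrite !gt_eqF.
    have -> : u - d2 < u + s * h < u by apply/andP; split; lra.
    by move=> /(_ isT); lra.
  + move=> w t h Iw /andP[t0 t1] h0 Iz.
    have := qd_ge_lpartial1 Iw Iz; rewrite addrAC subrr add0r.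
    have -> : w + t * (s * h) <= w.
      by rewrite gerDl mulr_ge0_le0// ltW// nmulr_rlt0.
    move=> /(_ isT); rewrite -lerN2 => /le_trans; apply.
    rewrite le_eqVlt; apply/orP; left; apply/eqP.
    by rewrite /s; field; rewrite gt_eqF.
- have p0 := rpartial1_gt0 Iu; set p := rpartial1 E u in p0 *.
  have e0 : E x u < 0 by rewrite (qd_lt0 E_qd).
  set e := E x u in e0 *.
  (* eps is reduced so that s stays positive. *)
  pose eps' := Num.min eps (- e / 2).
  have [eps'0 eps'e eps'_le] : [/\ 0 < eps', eps' <= - e / 2 & eps' <= eps].
    by rewrite /eps' !ge_min !lexx orbT lt_min eps0/=; split=> //; lra.
  have ee0 : e + eps' < 0 by lra.
  have bp : p < p * e / (e + eps') by rewrite ltr_ndivlMr// ltr_pM2l//; lra.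
  have [d2 d20 d2P] := rderive_lt_near I_open (E_convex Iu) Iu bp.
  pose s := - ((e + eps') / p).
  have s0 : 0 < s by rewrite oppr_gt0 pmulr_llt0 ?invr_gt0.
  exists s, (Num.min d1 d2 / s); split.
  + by rewrite divr_gt0// lt_min d10.
  + move=> h /andP[h0]; rewrite ltr_pdivlMr// lt_min => /andP[hd1 hd2].
    have sh0 : 0 < s * h by rewrite mulr_gt0.
    split; first by apply: d1I; rewrite ger0_norm; lra.
    have := d2P (u + s * h); rewrite (qd_diag E_qd Iu) subr0.
    have -> : p * e / (e + eps') * (u + s * h - u) = - (h * e).
      by rewrite /s; field; rewrite (gt_eqF p0) (lt_eqF ee0).
    have -> : u < u + s * h < u + d2 by apply/andP; split; lra.
    by move=> /(_ isT); lra.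
  + move=> w t h Iw /andP[t0 t1] h0 Iz.
    have := qd_ge_rpartial1 Iw Iz; rewrite addrAC subrr add0r.
    have -> : w <= w + t * (s * h) by rewrite lerDl mulr_ge0// ltW// mulr_gt0.
    move=> /(_ isT); rewrite -lerN2 => /le_trans; apply.
    have -> : - (rpartial1 E w * (t * (s * h))) =
        h * (t * (rpartial1 E w / p) * (e + eps')).
      by rewrite /s; field; rewrite gt_eqF.
    rewrite ler_pM2l//; apply: ler_wpM2l; last by rewrite lerD2l.
    by rewrite mulr_ge0// divr_ge0// ltW// rpartial1_gt0.
Qed.

End ConvexSections.

(** * Joint convexity of the normalized quasideviation *)

Section JointConvexity.
Context {R : realType} {I : set R} {E : R -> R -> R}.
Hypotheses (I_open : open I) (I_itv : is_interval I).
Hypothesis E_qd : quasideviation I E.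
Hypothesis D_jensen : jensen_convex I (@qdmean R I E).

Let E_convex u : I u -> convex_on I (E^~ u) :=
  @qd_convex R I E I_open I_itv E_qd D_jensen u.

(** [qd_sum_conv] for (x, u+s/m, ..., u, ...) and (y, v, ..., v+r/m, ...).
    Pairing the perturbed entries with unperturbed ones keeps the two
    compensations apart, whatever the signs of E(x,u) and E(y,v). *)
Lemma qd_compensated_conv (x y u v w t : R) :
  I x -> I y -> I u -> I v -> 0 <= t <= 1 ->
  w = t * u + (1 - t) * v ->
  E (t * x + (1 - t) * y) w <=
    t * (compensating_slope E u x w / compensating_slope E u x u) * E x u +
    (1 - t) * (compensating_slope E v y w / compensating_slope E v y v) * E y v.
Proof.
move=> Ix Iy Iu Iv t01 wE.
pose sx := compensating_slope E u x; pose sy := compensating_slope E v y.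
rewrite -/sx -/sy.
have t01' : 0 <= 1 - t <= 1 by move: t01 => /andP[t0 t1]; lra.
have Iw : I w by rewrite wE; exact: interval_conv.
set a := t * (sx w / sx u); set b := (1 - t) * (sy w / sy v).
have [t0 t1] := andP t01; have [t0' _] := andP t01'.
have spos := compensating_slope_gt0 I_open E_qd E_convex.
have a0 : 0 <= a by rewrite mulr_ge0// divr_ge0// ltW// spos.
have b0 : 0 <= b by rewrite mulr_ge0// divr_ge0// ltW// spos.
apply/ler_addgt0Pl => eta eta0.
pose eps := eta / (a + b + 1).
have eps0 : 0 < eps by rewrite divr_gt0//; lra.
have epsE : (a + b) * eps <= eta.
  by rewrite /eps mulrA ler_pdivrMr ?(mulrC _ eta) ?ler_pM2l//; lra.
have [s [d [d0 sP sE]]] := compensate I_open E_qd E_convex Iu Ix eps0.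
have [r [d' [d'0 rP rE]]] := compensate I_open E_qd E_convex Iv Iy eps0.
have dd0 : 0 < Num.min d d' by rewrite lt_min d0.
have [m [m0 mP]] : exists m : nat, 0 < m%:R :> R /\ (Num.min d d')^-1 < m%:R.
  by exists (Num.truncn (Num.min d d')^-1).+1; rewrite ltr0n truncnS_gt.
pose h : R := m%:R^-1.
have h0 : 0 < h by rewrite invr_gt0.
have mh : m%:R * h = 1 by rewrite mulfV// gt_eqF.
have /andP[hd hd'] : (h < d) && (h < d').
  by rewrite -lt_min -[ltRHS]invrK ltf_pV2 ?posrE ?invr_gt0.
have [Ius sumu] : I (u + s * h) /\ h * E x u + E (u + s * h) u <= 0.
  by apply: sP; rewrite h0.
have [Ivr sumv] : I (v + r * h) /\ h * E y v + E (v + r * h) v <= 0.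
  by apply: rP; rewrite h0.
have := @qd_sum_conv R I E I_itv E_qd D_jensen
  ((x, y) :: nseq m (u + s * h, v) ++ nseq m (u, v + r * h)) u v t.
rewrite !big_cons !big_cat !sum_nseq/= !(qd_diag E_qd)// -wE.
have -> : t * (u + s * h) + (1 - t) * v = w + t * (s * h) by rewrite wE; ring.
have -> : t * u + (1 - t) * (v + r * h) = w + (1 - t) * (r * h).
  by rewrite wE; ring.
have Iws : I (w + t * (s * h)).
  have -> : w + t * (s * h) = t * (u + s * h) + (1 - t) * v by rewrite wE; ring.
  exact: interval_conv.
have Iwr : I (w + (1 - t) * (r * h)).
  have -> : w + (1 - t) * (r * h) = t * u + (1 - t) * (v + r * h).
    by rewrite wE; ring.
  exact: interval_conv.
have sE' := sE w t h Iw t01 h0 Iws; have rE' := rE w (1 - t) h Iw t01' h0 Iwr.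
rewrite -(ler_pM2l m0) (mulrA m%:R h) mh mul1r mulrN in sE'.
rewrite -(ler_pM2l m0) (mulrA m%:R h) mh mul1r mulrN in rE'.
rewrite -(ler_pM2l m0) mulrDr (mulrA m%:R h) mh mul1r mulr0 in sumu.
rewrite -(ler_pM2l m0) mulrDr (mulrA m%:R h) mh mul1r mulr0 in sumv.
rewrite -/sx -/a in sE'; rewrite -/sy -/b in rE'.
rewrite !mulr0 !addr0 ?add0r => H.
have {H} : E (t * x + (1 - t) * y) w +
    (m%:R * E (w + t * (s * h)) w + m%:R * E (w + (1 - t) * (r * h)) w) <= 0.
  apply: H => // p; rewrite inE mem_cat !mem_nseq.
  by move=> /or3P[/eqP->|/andP[_ /eqP->]|/andP[_ /eqP->]].
move: sE' rE' epsE; rewrite mulrDr (mulrDr b) mulrDl; lra.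
Qed.

(** Take v beyond w as seen from u, and let x decrease to u in
    [qd_compensated_conv] with y = v: the left-hand side sees the right slope at
    w, while the compensation uses the left slopes at u and w. *)
Lemma partial1_ratio_le (u w : R) : I u -> I w ->
  rpartial1 E w / lpartial1 E w <= rpartial1 E u / lpartial1 E u.
Proof.
move=> Iu Iw; have [->//|uw] := eqVneq u w.
have [v [t [Iv t0 t1 wE]]] : exists v t,
    [/\ I v, 0 < t, t <= 1 & w = t * u + (1 - t) * v].
  have [uw'|wu|/eqP] := ltgtP u w; last by rewrite (negPf uw).
    have [v Iv wv] := open_above I_open Iw; exists v, ((v - w) / (v - u)).
    have vu : 0 < v - u by lra.
    split=> //; first by rewrite divr_gt0// subr_gt0.
      by rewrite ler_pdivrMr//; lra.
    by field; rewrite gt_eqF.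
  have [v Iv vw] := open_below I_open Iw; exists v, ((w - v) / (u - v)).
  have vu : 0 < u - v by lra.
  split=> //; first by rewrite divr_gt0// subr_gt0.
    by rewrite ler_pdivrMr//; lra.
  by field; rewrite gt_eqF.
have qw0 := lpartial1_gt0 I_open E_qd E_convex Iw.
have qu0 := lpartial1_gt0 I_open E_qd E_convex Iu.
set qw := lpartial1 E w in qw0 *; set qu := lpartial1 E u in qu0 *.
set pw := rpartial1 E w; set pu := rpartial1 E u.
rewrite leNgt; apply/negP; rewrite ltr_pdivrMr// mulrAC => lt_p.
set c := (X in _ < X) in lt_p.
have lt_b : pu < (pu + c) / 2 by rewrite midf_lt.
have t01 : 0 <= t <= 1 by rewrite ltW.
have c_le x : I x -> u < x -> c * (x - u) <= E x u.
  move=> Ix ux; have Iz := interval_conv I_itv Ix Iv t01.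
  have := qd_compensated_conv Ix Iv Iu Iv t01 wE.
  rewrite /compensating_slope (ltW ux) (qd_diag E_qd Iv) mulr0 addr0 -/qw -/qu.
  have zE : t * x + (1 - t) * v - w = t * (x - u) by rewrite wE; ring.
  have wz : w <= t * x + (1 - t) * v.
    by rewrite -subr_ge0 zE mulr_ge0 ?subr_ge0// ltW.
  move=> /(le_trans (qd_ge_rpartial1 I_open E_qd E_convex Iw Iz wz)).
  have -> : rpartial1 E w * (t * x + (1 - t) * v - w) =
      t * (qw / qu) * (c * (x - u)).
    by rewrite zE /c -/pw; field; rewrite !gt_eqF.
  by rewrite ler_pM2l// mulr_gt0// divr_gt0.
have [d d0 dP] := rderive_lt_near I_open (E_convex Iu) Iu lt_b.
have [d' d'0 dI] := open_room I_open Iu.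
pose x := u + Num.min (d / 2) d'.
have min0 : 0 < Num.min (d / 2) d' by rewrite lt_min d'0 divr_gt0.
have min_d : Num.min (d / 2) d' <= d / 2 by rewrite ge_min lexx.
have min_d' : Num.min (d / 2) d' <= d' by rewrite ge_min lexx orbT.
have ux : u < x by rewrite /x ltrDl.
have Ix : I x by apply: dI; rewrite /x addrAC subrr add0r gtr0_norm.
have xd : u < x < u + d by rewrite ux /x; lra.
have : c * (x - u) <= (pu + c) / 2 * (x - u).
  apply: le_trans (c_le x Ix ux) _.
  by have := dP x xd; rewrite (qd_diag E_qd Iu) subr0.
rewrite ler_pM2r ?subr_gt0//; lra.
Qed.

Lemma partial1_ratio (u w : R) : I u -> I w ->
  rpartial1 E w / lpartial1 E w = rpartial1 E u / lpartial1 E u.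
Proof. by move=> Iu Iw; apply/eqP; rewrite eq_le !partial1_ratio_le. Qed.

Lemma compensating_slope_ratio (u w x : R) (s : R -> R) : I u -> I w ->
  s = lpartial1 E \/ s = rpartial1 E ->
  compensating_slope E u x w / compensating_slope E u x u = s w / s u.
Proof.
move=> Iu Iw sE.
have pw0 := rpartial1_gt0 I_open E_qd E_convex Iw.
have pu0 := rpartial1_gt0 I_open E_qd E_convex Iu.
have qw0 := lpartial1_gt0 I_open E_qd E_convex Iw.
have qu0 := lpartial1_gt0 I_open E_qd E_convex Iu.
have pq : rpartial1 E w / rpartial1 E u = lpartial1 E w / lpartial1 E u.
  have := partial1_ratio Iu Iw.
  move=> /(congr1 (fun z => z * (lpartial1 E w / rpartial1 E u))).
  rewrite mulrA divfK ?gt_eqF// => ->; field.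
  by rewrite !gt_eqF.
by rewrite /compensating_slope; case: sE => ->; case: ifP.
Qed.

Lemma qd_normalized_conv (s : R -> R) (x y u v t : R) :
  s = lpartial1 E \/ s = rpartial1 E ->
  I x -> I y -> I u -> I v -> 0 <= t <= 1 ->
  E (t * x + (1 - t) * y) (t * u + (1 - t) * v) / s (t * u + (1 - t) * v) <=
    t * (E x u / s u) + (1 - t) * (E y v / s v).
Proof.
move=> sE Ix Iy Iu Iv t01.
have Iw : I (t * u + (1 - t) * v) by exact: interval_conv.
have s0 z : I z -> 0 < s z.
  case: sE => -> Iz; first exact: (lpartial1_gt0 I_open E_qd E_convex Iz).
  exact: (rpartial1_gt0 I_open E_qd E_convex Iz).
have := qd_compensated_conv Ix Iy Iu Iv t01 erefl.
rewrite !(@compensating_slope_ratio _ _ _ s)// => H.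
rewrite ler_pdivrMr ?s0//; apply: le_trans H _.
rewrite le_eqVlt; apply/orP; left; apply/eqP.
by field; rewrite !gt_eqF ?s0.
Qed.

End JointConvexity.

(** * The equivalence and its consequences *)

Lemma normalized_convexP {R : realType} (I : set R) (E : R -> R -> R)
    (s : R -> R) :
  @convex_function R (R^o * R^o)%type (I `*` I) (fun p => E p.1 p.2 / s p.2) <->
  forall x y u v t, I x -> I y -> I u -> I v -> 0 <= t <= 1 ->
    E (t * x + (1 - t) * y) (t * u + (1 - t) * v) / s (t * u + (1 - t) * v) <=
      t * (E x u / s u) + (1 - t) * (E y v / s v).
Proof.
split=> [C x y u v t Ix Iy Iu Iv /andP[t0 t1]|C t [x u] [y v]].
  by apply: (C (Itv01 t0 t1) (x, u) (y, v)); apply/mem_set.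
move=> /set_mem[/= Ix Iu] /set_mem[/= Iy Iv].
by apply: C => //; rewrite ge0 le1.
Qed.

Section NormalizedConvex.
Context {R : realType} {I : set R} {E : R -> R -> R}.
Hypotheses (I_open : open I) (I_itv : is_interval I).
Hypothesis E_qd : quasideviation I E.

Lemma qd_continuous x u : I x -> I u -> {for u, continuous (E x)}.
Proof.
move=> Ix Iu; case: E_qd => _ + _ => /(_ x Ix).
by rewrite continuous_open_subspace// => /(_ u (mem_set Iu)).
Qed.

(** Summing the midpoint inequality at u = D(x), v = D(y) makes both sums on the
    right vanish. *)
Lemma normalized_convex_jensen (s : R -> R) : (forall u, I u -> 0 < s u) ->
  @convex_function R (R^o * R^o)%type (I `*` I) (fun p => E p.1 p.2 / s p.2) ->
  jensen_convex I (@qdmean R I E).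
Proof.
move=> s0 /normalized_convexP C n x y n0 Ix Iy.
have [Iu Su] := qdmeanP I_itv E_qd n0 Ix.
have [Iv Sv] := qdmeanP I_itv E_qd n0 Iy.
set u := qdmean I E x in Iu Su *; set v := qdmean I E y in Iv Sv *.
have half01 : (0 : R) <= 2^-1 <= (1 : R) by lra.
have halfE a b : (a + b) / 2 = 2^-1 * a + (1 - 2^-1) * b :> R by field.
have zE i : (2^-1 *: (x + y)) ord0 i =
    2^-1 * x ord0 i + (1 - 2^-1) * y ord0 i.
  by rewrite !mxE; field.
rewrite halfE; set w := 2^-1 * u + (1 - 2^-1) * v.
have Iw : I w by exact: interval_conv.
rewrite (qdmean_le I_itv E_qd n0)//; last first.
  by move=> i; rewrite zE; exact: interval_conv.
rewrite -(pmulr_lle0 _ (_ : 0 < (s w)^-1)) ?invr_gt0 ?s0// mulr_suml.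
apply: (@le_trans _ _ (\sum_i (2^-1 * (E (x ord0 i) u / s u) +
                         (1 - 2^-1) * (E (y ord0 i) v / s v)))).
  by apply: ler_sum => i _; rewrite zE; exact: C.
by rewrite big_split/= -!mulr_sumr -!mulr_suml Su Sv !mul0r !mulr0 addr0.
Qed.

End NormalizedConvex.

Section Consequences.
Context {R : realType} {I : set R} {E : R -> R -> R}.
Hypotheses (I_open : open I) (I_itv : is_interval I).
Hypothesis E_qd : quasideviation I E.
Hypothesis D_jensen : jensen_convex I (@qdmean R I E).

Let E_convex u : I u -> convex_on I (E^~ u) :=
  @qd_convex R I E I_open I_itv E_qd D_jensen u.

Lemma jensen_normalized_convex (s : R -> R) :
  s = lpartial1 E \/ s = rpartial1 E ->
  @convex_function R (R^o * R^o)%type (I `*` I) (fun p => E p.1 p.2 / s p.2).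
Proof.
move=> sE; apply/normalized_convexP => x y u v t Ix Iy Iu Iv t01.
exact: (qd_normalized_conv I_open I_itv E_qd D_jensen sE).
Qed.

Lemma jensen_rnormalized_convex : rnormalized_convex I E.
Proof.
split=> [u Iu|]; last by apply: jensen_normalized_convex; right.
split; first exact: (convex_rderivable I_open (E_convex Iu)).
exact: (rpartial1_gt0 I_open E_qd E_convex Iu).
Qed.

Lemma jensen_lnormalized_convex : lnormalized_convex I E.
Proof.
split=> [u Iu|]; last by apply: jensen_normalized_convex; left.
split; first exact: (convex_lderivable I_open (E_convex Iu)).
exact: (lpartial1_gt0 I_open E_qd E_convex Iu).
Qed.

(** E is convex in the first variable and continuous in the second; the
    Lipschitz constant around x depends on u only through values of E at the
    three points x - d, x, x + d, hence stays bounded near u. *)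
Lemma qd_joint_continuous :
  {within I `*` I, continuous (fun p : R * R => E p.1 p.2)}.
Proof.
rewrite continuous_open_subspace; last first.
  by apply: (@openI _ (fst @^-1` I) (snd @^-1` I)); apply: open_comp => // p _;
    [exact: cvg_fst|exact: cvg_snd].
move=> [x u] /set_mem[/= Ix Iu].
have [d d0 dI] := open_room I_open Ix.
have Ixd : I (x + d) by apply: dI; rewrite addrAC subrr add0r gtr0_norm.
have Ixd' : I (x - d).
  by apply: dI; rewrite addrAC subrr add0r normrN gtr0_norm.
have cE z : I z -> E z p.2 @[p --> (x, u)] --> E z u.
  move=> Iz; apply: (@cvg_comp _ _ _ snd (E z) _ (nbhs u)).
    exact: cvg_snd.
  exact: (qd_continuous I_open E_qd Iz Iu).
have nI : nbhs u I by exact: open_nbhs_nbhs.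
pose G v := `|E (x + d) v - E x v| + `|E (x - d) v - E x v|.
apply: (@cvg_dominated _ _ _ _ _
  (fun p => `|p.1 - x| / d * G p.2 + `|E x p.2 - E x u|)).
  near=> p.
  have Ip : I p.2 by near: p; exact: (cvg_snd nI).
  have xd : `|p.1 - x| <= d.
    by near: p; apply: cvgr_distC_le => //; exact: cvg_fst.
  have -> : E p.1 p.2 - E x u = (E p.1 p.2 - E x p.2) + (E x p.2 - E x u).
    by ring.
  apply: le_trans (ler_normD _ _) _; rewrite lerD2r.
  by apply: (convex_lipschitz (E_convex Ip)) => //; exact: dI.
rewrite [X in _ --> X](_ : 0 = `|x - x| / d * G u + `|E x u - E x u|);
  last first.
  by rewrite !subrr normr0 !mul0r addr0.
apply: cvgD; last by apply: cvg_norm; apply: cvgB; [exact: cE|exact: cvg_cst].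
apply: cvgM.
  apply: cvgM; last exact: cvg_cst.
  by apply: cvg_norm; apply: cvgB; [exact: cvg_fst|exact: cvg_cst].
by apply: cvgD; apply: cvg_norm; apply: cvgB; exact: cE.
Unshelve. all: by end_near. Qed.

(** For x fixed above u, the normalized E(x, .) is convex, hence continuous, and
    E(x, .) is continuous by (D2); s is their quotient near u. *)
Lemma partial1_continuous (s : R -> R) (u : R) :
  s = lpartial1 E \/ s = rpartial1 E -> I u -> {for u, continuous s}.
Proof.
move=> sE Iu; have [x Ix ux] := open_above I_open Iu.
have s0 v : I v -> 0 < s v.
  case: sE => -> Iz; first exact: (lpartial1_gt0 I_open E_qd E_convex Iz).
  exact: (rpartial1_gt0 I_open E_qd E_convex Iz).
pose g v := E x v / s v.
have gC : convex_on I g.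
  move=> v w t Iv Iw t01.
  have := qd_normalized_conv I_open I_itv E_qd D_jensen sE Ix Ix Iv Iw t01.
  by rewrite -mulrDl addrC subrK mul1r.
have gE v : I v -> v < x -> E x v / g v = s v.
  move=> Iv vx; have Exv : 0 < E x v by rewrite (qd_gt0 E_qd).
  have sv := s0 v Iv.
  by rewrite /g; field; rewrite !gt_eqF.
have gu : g u != 0.
  by rewrite mulf_neq0 ?invr_neq0 ?gt_eqF ?s0// (qd_gt0 E_qd).
have : E x v / g v @[v --> u] --> s u.
  rewrite -gE//; apply: cvgM; first exact: (qd_continuous I_open E_qd Ix Iu).
  by apply: cvgV => //; exact: (convex_continuous I_open gC Iu).
have nI : nbhs u I by exact: open_nbhs_nbhs.
apply: cvg_trans; apply: near_eq_cvg; near=> v.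
rewrite gE//; first by near: v; exact: nI.
by near: v; exact: lt_nbhsl.
Unshelve. all: by end_near. Qed.

Lemma mean_le_qdmean n (x : 'rV[R]_n) : (0 < n)%N ->
  (forall i, I (x ord0 i)) -> (\sum_(i < n) x ord0 i) / n%:R <= qdmean I E x.
Proof.
move=> n0 Ix; have [Iu Su] := qdmeanP I_itv E_qd n0 Ix.
set u := qdmean I E x in Iu Su *.
have p0 := rpartial1_gt0 I_open E_qd E_convex Iu.
have tangent y : I y -> rpartial1 E u * (y - u) <= E y u.
  move=> Iy; have [uy|yu] := leP u y.
    exact: (qd_ge_rpartial1 I_open E_qd E_convex Iu Iy uy).
  apply: le_trans (qd_ge_lpartial1 I_open E_qd E_convex Iu Iy (ltW yu)).
  rewrite ler_wnM2r ?subr_le0 ?(ltW yu)//.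
  exact: (convex_lderive_le_rderive I_open (E_convex Iu)).
have : rpartial1 E u * \sum_i (x ord0 i - u) <= 0.
  apply: (@le_trans _ _ (\sum_i E (x ord0 i) u)); last by rewrite Su.
  by rewrite mulr_sumr; apply: ler_sum => i _; exact: tangent.
rewrite pmulr_rle0// sumrB sumr_const card_ord subr_le0.
by rewrite ler_pdivrMr ?ltr0n// mulr_natr.
Qed.

End Consequences.

Theorem theorem2p2 (R : realType) (I : set R) (E : R -> R -> R)
    (I_open : open I) (I_itv : is_interval I) (I_neq0 : I !=set0)
    (E_qd : quasideviation I E) :
  [<-> jensen_convex I (@qdmean R I E);
       rnormalized_convex I E;
       lnormalized_convex I E]
  /\
  (jensen_convex I (@qdmean R I E) \/
   rnormalized_convex I E \/
   lnormalized_convex I E ->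
   [/\ {within I `*` I, continuous (fun p : R * R => E p.1 p.2)},
       forall u, I u -> @convex_function R R^o I (fun x => E x u),
       (forall u, I u -> lderivable (E^~ u) u /\ rderivable (E^~ u) u) /\
       {within I, continuous (fun u => (lpartial1 E u, rpartial1 E u))},
       exists c : R, forall u, I u -> rpartial1 E u / lpartial1 E u = c
     & forall (n : nat) (x : 'rV[R]_n), (0 < n)%N ->
         (forall i, I (x ord0 i)) ->
         (\sum_(i < n) x ord0 i) / n%:R <= qdmean I E x]).
Proof.
have rJ : rnormalized_convex I E -> jensen_convex I (@qdmean R I E).
  by move=> [p0]; apply: normalized_convex_jensen => // u /p0[].
have lJ : lnormalized_convex I E -> jensen_convex I (@qdmean R I E).
  by move=> [q0]; apply: normalized_convex_jensen => // u /q0[].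
split.
  tfae; [exact: jensen_rnormalized_convex| |exact: lJ].
  by move=> /rJ; exact: jensen_lnormalized_convex.
move=> cases; have {rJ lJ cases} D_jensen : jensen_convex I (@qdmean R I E).
  by case: cases => [//|[/rJ|/lJ]].
have E_convex := qd_convex I_open I_itv E_qd D_jensen.
split.
- exact: qd_joint_continuous.
- by move=> u Iu; apply/convex_functionP/E_convex.
- split=> [u Iu|].
    by split; [exact: (convex_lderivable I_open (E_convex u Iu))
              |exact: (convex_rderivable I_open (E_convex u Iu))].
  rewrite continuous_open_subspace// => u /set_mem Iu.
  have lc : {for u, continuous (lpartial1 E)}.
    by apply: (partial1_continuous I_open I_itv E_qd D_jensen) Iu; left.
  have rc : {for u, continuous (rpartial1 E)}.
    by apply: (partial1_continuous I_open I_itv E_qd D_jensen) Iu; right.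
  exact: (cvg_pair lc rc).
- have [u0 Iu0] := I_neq0.
  exists (rpartial1 E u0 / lpartial1 E u0) => u Iu.
  exact: (partial1_ratio I_open I_itv E_qd D_jensen Iu0 Iu).
- by move=> n x n0 Ix; exact: (mean_le_qdmean I_open I_itv E_qd D_jensen n0 Ix).
Qed.
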